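(* Let $a,b\ge1$ be integers. The order of $K\text{-}\mathrm{Pro}$ on $\mathrm{Inc}^{a+b+1}(a\times b)$ is $a+b+1$; that is, $a+b+1$ is the smallest positive integer $m$ such that $(K\text{-}\mathrm{Pro})^m$ is the identity on $\mathrm{Inc}^{a+b+1}(a\times b)$.
   Context: **Increasing tableaux.** An increasing tableau of shape $a\times b$ is a filling of the rectangle with $a$ rows and $b$ columns by positive integers that strictly increase from left to right along rows and from top to bottom down columns. $\mathrm{Inc}^q(a\times b)$ is the set of those with all entries at most $q$ (not every integer in $\{1,\dots,q\}$ need appear). **$K$-promotion.** For $T\in\mathrm{Inc}^q(a\times b)$, delete all labels $1$. Then for $i=2,3,\dots,q$ in turn, consider the set of boxes that are currently empty or contain $i$, and decompose it into connected components (adjacency = sharing an edge). In each component with more than one box, simultaneously delete every label $i$ and place $i$ in every box that was empty; leave one-box components unchanged. Finally, fill the remaining empty boxes with $q+1$ and subtract $1$ from every entry. The result is $K\text{-}\mathrm{Pro}(T)\in\mathrm{Inc}^q(a\times b)$. $K\text{-}\mathrm{Pro}$ is a bijection of $\mathrm{Inc}^q(a\times b)$. *)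

(* Defs.v *)
From mathcomp Require Import all_boot all_algebra.

Set Implicit Arguments.
Unset Strict Implicit.
Unset Printing Implicit Defensive.

Section Tableaux.

Variables a b : nat.

Definition box : finType := ('I_a * 'I_b)%type.

Definition Inc (q : nat) : pred 'M[nat]_(a, b) := fun T =>
  [&& [forall i, forall j, 1 <= T i j <= q],
      [forall i, forall j1 : 'I_b, forall j2 : 'I_b, (j1 < j2) ==> (T i j1 < T i j2)]
    & [forall j, forall i1 : 'I_a, forall i2 : 'I_a, (i1 < i2) ==> (T i1 j < T i2 j)]].

Definition adjacent : rel box := fun x y =>
  ((x.1 == y.1) && ((x.2.+1 == y.2 :> nat) || (y.2.+1 == x.2 :> nat)))
  || ((x.2 == y.2) && ((x.1.+1 == y.1 :> nat) || (y.1.+1 == x.1 :> nat))).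

(* Partially emptied fillings; [None] is an empty box. *)
Definition filling := 'M[option nat]_(a, b).

Definition active (i : nat) (U : filling) : {set box} :=
  [set x : box | (U x.1 x.2 == None) || (U x.1 x.2 == Some i)].

Definition component (S : {set box}) (x : box) : {set box} :=
  [set y | connect (fun u v => [&& u \in S, v \in S & adjacent u v]) x y].

Definition kswap (i : nat) (U : filling) : filling :=
  (\matrix_(r, c)
    (if ((r, c) \in active i U) && (1 < #|component (active i U) (r, c)|)
     then (if U r c == None then Some i else None)
     else U r c)%N)%R.

Definition delete1 (T : 'M[nat]_(a, b)) : filling :=
  (\matrix_(r, c) (if T r c == 1 then None else Some (T r c))%N)%R.

(* [iota 2 q.-1] is the sequence 2, 3, ..., q. *)
Definition KPro (q : nat) (T : 'M[nat]_(a, b)) : 'M[nat]_(a, b) :=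
  let U := foldl (fun V i => kswap i V) (delete1 T) (iota 2 q.-1) in
  (\matrix_(r, c) ((odflt q.+1 (U r c)).-1)%N)%R.

End Tableaux.

Definition is_order_on (X : Type) (A : pred X) (f : X -> X) (n : nat) : Prop :=
  [/\ 0 < n,
      forall x, A x -> iter n f x = x
    & forall m, 0 < m -> (forall x, A x -> iter m f x = x) -> n <= m].

(* Main.v *)
Require Import Defs.
From mathcomp Require Import all_boot all_order all_algebra zify.

Set Implicit Arguments.
Unset Strict Implicit.
Unset Printing Implicit Defensive.

(** Write q = a + b + 1 and t n r c for the entry in box (r, c) of the n-th
    K-promotion of a tableau.  There is so little room below q that
    r + c + 1 <= t n r c <= r + c + 3, so the tableau is the same thing as the
    two families of booleans t n r c <= r + c + k + 1, for k = 0, 1: an order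
    ideal in the product of chains a x b x 2.  K-promotion is a composition of
    Bender-Knuth involutions (KPro_bk_sweep), and each of these toggles the
    elements lying on one plane r + c + k = constant.  So the
    orbit is a boolean field on space and time, in which the new value at a
    point is determined by the old one and by the current values at its
    neighbours (KPro_le, cellS).

    Such a field can be cut along other slices.  Collect the points by the
    diagonals r - c = constant, and choose the time so that a diagonal is seen
    at a single instant.  Only the number of points present on a diagonal then
    matters; with these numbers, L1 i j on level k = 1 and L2 i j on level k = 0,
    the field becomes the growth diagram of an increasing tableau with 2 rows,
    a columns and entries at most q (tight_orbit_growth).  Here i counts the promotions of that second tableau
    and (L1 i j, L2 i j) is the shape of its entries at most j - i.

    For two rows, the shapes at (i, j) and at (j, i + q) turn out to be
    complementary in the rectangle.  One inequality, for L1 j (i + q) against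
    L2 i j, is proved by induction on the growth diagram
    (growth_shift_ineq); complementation maps growth diagrams to growth
    diagrams (growth_dual), which gives the other inequality one period later.
    Hence L2 (i + q) (j + q) <= L2 i j.  K-promotion is injective on a finite
    set, so L2 is also periodic, and a periodic function cannot decrease:
    L2, then L1, then the field itself have period q.

    For minimality, the set of labels present in a tableau is rotated by K-promotion
    (has_label_KPro).  The smallest tableau uses exactly the labels 1, ..., q - 2,
    and no rotation by 0 < m < q preserves that set. *)

(** * K-promotion as a sweep of Bender-Knuth involutions *)

Section BenderKnuth.
Variables a b : nat.
Implicit Types (V T : 'M[nat]_(a, b)) (x y : box a b).

Definition covers : rel (box a b) := fun x y =>
  ((x.1 == y.1) && (x.2.+1 == y.2 :> nat)) || ((x.2 == y.2) && (x.1.+1 == y.1 :> nat)).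

Lemma adjacentE x y : adjacent x y = covers x y || covers y x.
Proof.
rewrite /adjacent /covers [y.1 == _]eq_sym [y.2 == x.2]eq_sym.
by case: (x.1 == y.1); case: (x.2 == y.2); rewrite ?orbF ?orbA //=; do !case: eqP.
Qed.

Definition label V x : nat := V x.1 x.2.

Definition bk_active (j : nat) V x := (label V x == j) || (label V x == j.+1).

Definition bk_free j V x :=
  bk_active j V x && ~~ [exists y, adjacent x y && bk_active j V y].

(** The K-Bender-Knuth involution: j and j + 1 are exchanged in the boxes where
    no neighbour carries one of these two labels. *)
Definition bk j V : 'M[nat]_(a, b) :=
  (\matrix_(r, c) (if bk_free j V (r, c) then
     if V r c == j then j.+1 else j else V r c))%R.

Lemma bkE j V x : label (bk j V) x =
  if bk_free j V x then if label V x == j then j.+1 else j else label V x.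
Proof. by rewrite /label mxE -surjective_pairing. Qed.

Lemma bk_active_bk j V : bk_active j (bk j V) =1 bk_active j V.
Proof.
move=> x; rewrite {1}/bk_active bkE /bk_free.
case E: (bk_active j V x) => //=; case: ifP => // _.
by case: ifP => _; rewrite ?eqxx ?orbT.
Qed.

Lemma bkK j : involutive (bk j).
Proof.
move=> V; apply/matrixP => r c; rewrite -[LHS]/(label (bk j (bk j V)) (r, c)).
rewrite -[RHS]/(label V (r, c)); move: (r, c) => x; rewrite !bkE.
have -> : bk_free j (bk j V) x = bk_free j V x.
  by rewrite /bk_free bk_active_bk; under eq_existsb => y do rewrite bk_active_bk.
case free: (bk_free j V x) => //.
move: free; rewrite /bk_free => /andP[+ _]; rewrite /bk_active.
by case: (label V x =P j); do ?case: ifP; lia.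
Qed.

(** Only the first step of a path matters, so the component size in K-promotion
    is a condition on the neighbours alone. *)
Lemma component_gt1 (S : {set box a b}) x : x \in S ->
  (1 < #|component S x|) = [exists y, adjacent x y && (y \in S)].
Proof.
move=> xS; have xC : x \in component S x by rewrite inE connect0.
apply/idP/existsP => [|[y /andP[xy yS]]]; last first.
  rewrite (cardD1 x) xC (cardD1 y) inE /= [y \in component _ _]inE.
  rewrite connect1 ?xS ?yS //= andbT.
  case: eqP => // yx; move: xy; rewrite yx adjacentE /covers !eqxx /=; lia.
rewrite (cardD1 x) xC ltnS => /card_gt0P[z]; rewrite !inE => /andP[zx].
case/connectP => [[|y p]] /=; first by move=> _ zE; rewrite zE eqxx in zx.
by case/andP=> /and3P[_ yS xy] _ _; exists y; rewrite xy.
Qed.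

(** The filling reached once the labels 2, ..., i are treated, read as a tableau:
    a treated label has lost its unit in advance, an untreated one has not, and
    an empty box stands for i.  For i = 1 this is the original tableau, for
    i = q its K-promotion. *)
Definition unbullet (i : nat) (U : filling a b) : 'M[nat]_(a, b) :=
  (\matrix_(r, c) (if U r c is Some v then if v <= i then v.-1 else v else i)%N)%R.

Lemma unbullet_active i U x : 0 < i -> (x \in active i.+1 U) = bk_active i (unbullet i U) x.
Proof.
move=> i0; rewrite inE /bk_active /label mxE; case: (U _ _) => [v|]; last by rewrite !eqxx.
rewrite /= -[Some v == Some _]/(v == i.+1); case: ifP; lia.
Qed.

(** In a component with several boxes, an empty box next to a label i + 1 reads
    i next to i + 1 before and after the exchange; in an isolated box the value
    i (empty) becomes i + 1, and the label i + 1 becomes i. *)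
Lemma unbullet_kswap i U : 0 < i -> unbullet i.+1 (kswap i.+1 U) = bk i (unbullet i U).
Proof.
move=> i0; apply/matrixP => r c; rewrite [LHS]mxE [kswap _ _ _ _]mxE [RHS]mxE.
rewrite /bk_free -(unbullet_active U (r, c) i0).
have [act|nact] /= := boolP ((r, c) \in active i.+1 U); last first.
  move: nact; rewrite inE /= mxE; case: (U r c) => [v|] //=.
  rewrite -[Some v == Some _]/(v == i.+1); do !case: ifP; lia.
rewrite component_gt1 //.
under [in RHS]eq_existsb => y do rewrite -(unbullet_active U y i0).
move: act; rewrite inE /= mxE; case: existsP => _ /=; case: (U r c) => [v|] //=.
- by rewrite -[Some v == Some _]/(v == i.+1) => /eqP ->; rewrite ltnn.
- by rewrite leqnn.
- by rewrite -[Some v == Some _]/(v == i.+1) => /eqP ->; rewrite ltnn leqnn; case: eqP; lia.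
- by rewrite eqxx.
Qed.

Definition bk_sweep m n V := foldl (fun W j => bk j W) V (iota m n).

Lemma bk_sweepD m n1 n2 V : bk_sweep m (n1 + n2) V = bk_sweep (m + n1) n2 (bk_sweep m n1 V).
Proof. by rewrite /bk_sweep iotaD foldl_cat. Qed.

Lemma bk_sweepS m n V : bk_sweep m n.+1 V = bk (m + n) (bk_sweep m n V).
Proof. by rewrite -addn1 bk_sweepD. Qed.

Lemma unbullet_run n T :
  unbullet n.+1 (foldl (fun U i => kswap i U) (delete1 T) (iota 2 n)) = bk_sweep 1 n T.
Proof.
elim: n => [|n IHn]; first by apply/matrixP => r c; rewrite !mxE; case: (T r c) => [|[|v]].
by rewrite -[X in iota 2 X]addn1 iotaD foldl_cat /= add2n unbullet_kswap // bk_sweepS IHn.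
Qed.

(** Comparing neighbours only is what lets monotonicity be followed through a
    single involution; the equivalence with the global form is IncP. *)
Definition incr (q : nat) V :=
  (forall x, 1 <= label V x <= q) /\
  (forall x y, covers x y -> label V x < label V y).

Lemma IncP q V : Inc q V <-> incr q V.
Proof.
split=> [/and3P[/forallP bnd /forallP rows /forallP cols]|[bnd cov]].
  split=> [x|[r c] [r' c']]; first exact: (forallP (bnd x.1) x.2).
  case/orP=> /= /andP[/eqP -> /eqP E].
    have /forallP/(_ c)/forallP/(_ c')/implyP := rows r'; apply; lia.
  have /forallP/(_ r)/forallP/(_ r')/implyP := cols c'; apply; lia.
apply/and3P; split.
- by apply/forallP => i; apply/forallP => j; have := bnd (i, j).
- apply/forallP => i; apply/forallP => j1; apply/forallP => -[n nb]; apply/implyP => /=.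
  elim: n nb => // n IHn nb; rewrite ltnS leq_eqVlt => /orP[/eqP jn|jn].
    by apply: (cov (i, j1) (i, Ordinal nb)); rewrite /covers /= eqxx jn eqxx.
  apply: ltn_trans (IHn (ltnW nb) jn) _.
  by apply: (cov (i, Ordinal (ltnW nb)) (i, Ordinal nb)); rewrite /covers /= !eqxx.
- apply/forallP => i; apply/forallP => j1; apply/forallP => -[n nb]; apply/implyP => /=.
  elim: n nb => // n IHn nb; rewrite ltnS leq_eqVlt => /orP[/eqP jn|jn].
    by apply: (cov (j1, i) (Ordinal nb, i)); rewrite /covers /= !eqxx jn eqxx orbT.
  apply: ltn_trans (IHn (ltnW nb) jn) _.
  by apply: (cov (Ordinal (ltnW nb), i) (Ordinal nb, i)); rewrite /covers /= !eqxx orbT.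
Qed.

Lemma bk_blocked j V x y : covers x y -> bk_active j V x -> bk_active j V y ->
  bk_free j V x = false /\ bk_free j V y = false.
Proof.
move=> xy ax ay; rewrite /bk_free ax ay /=; split; apply: negbTE; apply/negPn/existsP.
  by exists y; rewrite adjacentE xy /= ay.
by exists x; rewrite adjacentE xy orbT /= ax.
Qed.

(** Values move by at most one, so only neighbours carrying j and j + 1 could
    collide, and these block each other. *)
Lemma incr_bk q j V : 0 < j < q -> incr q V -> incr q (bk j V).
Proof.
move=> jq [bnd cov]; split=> [x|x y xy]; rewrite !bkE.
  by have := bnd x; do !case: ifP; lia.
have := cov x y xy; have := bk_blocked (j := j) (V := V) xy.
have freeact z : bk_free j V z -> bk_active j V z by case/andP.
move: (freeact x) (freeact y); rewrite /bk_active.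
move: (bk_free j V x) (bk_free j V y) => [] [];
  case: (label V x =P j); case: (label V y =P j) => /=; lia.
Qed.

Lemma incr_bk_sweep q m n V : 0 < m -> m + n <= q -> incr q V -> incr q (bk_sweep m n V).
Proof.
move=> m0; elim: n => [|n IHn] // mnq incV; rewrite bk_sweepS.
by apply: incr_bk; [lia | apply: IHn; [lia |]].
Qed.

(** The bound by q matters: at the end every label has been treated, so the
    final subtraction of 1 agrees with the one made in advance. *)
Lemma KPro_bk_sweep q T : incr q T -> KPro q T = bk_sweep 1 q.-1 T.
Proof.
move=> incT; apply/matrixP => r c; rewrite mxE.
case: q => [|q] in incT *.
  by case: incT => /(_ (r, c)); lia.
have [bnd _] : incr q.+1 (bk_sweep 1 q T) by apply: incr_bk_sweep.
have := bnd (r, c).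
rewrite /label /= -unbullet_run mxE; set U := foldl _ _ _; case: (U r c) => [v|] //=.
by case: ifP => //; lia.
Qed.

Lemma incr_KPro q T : incr q T -> incr q (KPro q T).
Proof.
move=> incT; rewrite KPro_bk_sweep //.
case: q => [|q] in incT *; first exact: incT.
exact: incr_bk_sweep.
Qed.

Lemma bk_sweep_inj m n : injective (bk_sweep m n).
Proof.
elim: n => [|n IHn] T1 T2 //; rewrite !bk_sweepS => /(can_inj (bkK _)); exact: IHn.
Qed.

Lemma KPro_inj q T1 T2 : incr q T1 -> incr q T2 -> KPro q T1 = KPro q T2 -> T1 = T2.
Proof. by move=> i1 i2; rewrite !KPro_bk_sweep // => /bk_sweep_inj. Qed.

(** The sublevel set at height m only changes at the single involution of
    index m. *)
Lemma bk_le_ne j m V x : j != m -> (label (bk j V) x <= m) = (label V x <= m).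
Proof.
move=> jm; rewrite bkE; case free: (bk_free j V x) => //.
by move: free => /andP[+ _]; rewrite /bk_active; case: ifP; lia.
Qed.

Lemma bk_sweep_le_out m n l V x : ~~ (m <= l < m + n) ->
  (label (bk_sweep m n V) x <= l) = (label V x <= l).
Proof.
elim: n => [|n IHn] // lmn; rewrite bk_sweepS bk_le_ne; last by lia.
by apply: IHn; lia.
Qed.

Lemma bk_le q j V x : incr q V -> (label (bk j V) x <= j) =
  if label V x <= j then (label V x < j) || [exists y, covers x y && (label V y <= j.+1)]
  else (label V x <= j.+1) && [forall y, covers y x ==> (label V y < j)].
Proof.
move=> [_ cov]; rewrite bkE /bk_free; case: ifP => [/andP[act]|].
  rewrite negb_exists => /forallP free; have {}free y : adjacent x y -> ~~ bk_active j V y.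
    by have := free y; case: adjacent.
  move: act; rewrite {1}/bk_active; case: ifP => [/eqP Vxj _ | _ /= /eqP Vxj].
    rewrite Vxj leqnn !ltnn /=; apply/esym/negbTE/existsP => -[y /andP[xy]].
    have := cov _ _ xy; have := free y; rewrite adjacentE xy /bk_active => /(_ isT).
    by rewrite Vxj; lia.
  rewrite Vxj ltnn !leqnn /=; apply/esym/forallP => y; apply/implyP => yx.
  have := cov _ _ yx; have := free y; rewrite adjacentE yx orbT /bk_active => /(_ isT).
  by rewrite Vxj; lia.
move=> /negbT; rewrite negb_and negbK => stuck.
have [le_xj | lt_jx] := leqP (label V x) j.
  have [lt_xj | le_jx] := ltnP (label V x) j; first by [].
  have Exj : label V x = j by lia.
  move: stuck; rewrite {1}/bk_active Exj eqxx => /existsP[y /andP[+ acty]].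
  rewrite adjacentE => /orP[xy|yx]; last first.
    by move: acty; have := cov _ _ yx; rewrite /bk_active; lia.
  by apply/esym/existsP; exists y; rewrite xy; move: acty; rewrite /bk_active; lia.
have [le_xj1 | lt_j1x] := leqP (label V x) j.+1; last by [].
have Exj : label V x = j.+1 by lia.
move: stuck; rewrite {1}/bk_active Exj eqxx orbT => /existsP[y /andP[+ acty]].
rewrite adjacentE => /orP[xy|yx].
  by move: acty; have := cov _ _ xy; rewrite /bk_active; lia.
apply/esym/negbTE/forallPn; exists y; rewrite yx /=.
by move: acty; rewrite /bk_active; lia.
Qed.

(* rule *)
(** The toggle rule.  The box x leaves the sublevel set at height j unless it
    has already reached a smaller height or something above it holds it back; it
    enters if everything below it is already there.  When the involution of
    index j acts, heights below j have their final value and heights above j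
    still have the original one. *)
Lemma KPro_le q T x j : incr q T -> 0 < j < q ->
  (label (KPro q T) x <= j) =
  if label T x <= j then
    (label (KPro q T) x < j) || [exists y, covers x y && (label T y <= j.+1)]
  else (label T x <= j.+1) && [forall y, covers y x ==> (label (KPro q T) y < j)].
Proof.
case: j => // j incT jq; rewrite KPro_bk_sweep //.
have -> : q.-1 = j + (q - j.+2).+1 by lia.
rewrite bk_sweepD; set W := bk_sweep 1 j T; set P := bk_sweep _ _ W.
have incW : incr q W by apply: incr_bk_sweep => //; lia.
have TW y l : j < l -> (label T y <= l) = (label W y <= l).
  by move=> jl; rewrite bk_sweep_le_out //; lia.
have PW y : (label P y < j.+1) = (label W y < j.+1).
  by rewrite ltnS bk_sweep_le_out //; lia.
have PE : P = bk_sweep j.+2 (q - j.+2) (bk j.+1 W).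
  by rewrite /P -[(_ - _).+1]add1n bk_sweepD /= /bk_sweep /= !add1n addn1.
have -> : (label P x <= j.+1) = (label (bk j.+1 W) x <= j.+1).
  by rewrite PE bk_sweep_le_out //; lia.
rewrite (bk_le _ _ incW) PW !TW //.
under [in RHS]eq_existsb => y do rewrite TW //.
by under [in RHS]eq_forallb => y do rewrite PW.
Qed.

(** * Rotation of the set of labels *)

Definition has_label V l := [exists x, label V x == l].

Definition swapSn (j k : nat) := if k == j then j.+1 else if k == j.+1 then j else k.

Lemma swapSnK j : involutive (swapSn j).
Proof. by move=> k; rewrite /swapSn; case: (k =P j); case: (k =P j.+1); do ?case: ifP; lia. Qed.

Lemma incr_adjacent q V x y : incr q V -> adjacent x y -> label V x != label V y.
Proof. by move=> [_ cov]; rewrite adjacentE => /orP[] /cov; lia. Qed.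

(** An isolated box exchanges its label.  A blocked box keeps it, but then its
    neighbour carries the other label and is blocked too, so both labels are
    present before and after. *)
Lemma has_label_bk q j V k : 0 < j < q -> incr q V ->
  has_label (bk j V) k = has_label V (swapSn j k).
Proof.
move=> jq; move: V k.
have sub V k : incr q V -> has_label V k -> has_label (bk j V) (swapSn j k).
  move=> incV /existsP[x /eqP xk].
  have [act|nact] := boolP (bk_active j V x); last first.
    apply/existsP; exists x; rewrite bkE /bk_free (negbTE nact) /swapSn -xk.
    by move: nact; rewrite /bk_active; do 2!case: eqP => //.
  have [free|/negPn/existsP[y /andP[xy acty]]] :=
    boolP (~~ [exists y, adjacent x y && bk_active j V y]).
    apply/existsP; exists x; rewrite bkE /bk_free act free /swapSn -xk.
    by move: act; rewrite /bk_active; case: eqP => //= _ ->.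
  (* the blocking neighbour y carries the other of the two labels *)
  apply/existsP; exists y; rewrite bkE /bk_free acty /=.
  have -> /= : [exists z, adjacent y z && bk_active j V z].
    by apply/existsP; exists x; rewrite act andbT; move: xy; rewrite !adjacentE orbC.
  move: (incr_adjacent incV xy) act acty; rewrite /bk_active /swapSn -xk.
  by case: (label V x =P j); case: (label V x =P j.+1) => /=; lia.
move=> V k incV; apply/idP/idP => [|/(sub _ _ incV)]; last by rewrite swapSnK.
by move/(sub _ _ (incr_bk jq incV)); rewrite bkK.
Qed.

Lemma has_label_bk_sweep q m n V k : 0 < m -> m + n <= q -> incr q V ->
  has_label (bk_sweep m n V) k =
  has_label V (if m <= k < m + n then k.+1 else if k == m + n then m else k).
Proof.
move=> m0; elim: n k => [|n IHn] k mnq incV.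
  by rewrite addn0 ltnNge andbN; case: eqP => // ->.
have incW : incr q (bk_sweep m n V) by apply: incr_bk_sweep => //; lia.
rewrite bk_sweepS (has_label_bk _ _ incW) ?IHn //; try lia.
congr (has_label V); rewrite /swapSn.
by case: (k =P m + n); case: (k =P (m + n).+1); do ?case: ifP; lia.
Qed.

Lemma has_label_KPro q T k : incr q T -> 1 <= k <= q ->
  has_label (KPro q T) k = has_label T (if k == q then 1 else k.+1).
Proof.
move=> incT kq; rewrite KPro_bk_sweep // (@has_label_bk_sweep q) //; last by lia.
rewrite add1n prednK; last by lia.
by congr (has_label T); do ?case: ifP; lia.
Qed.

End BenderKnuth.

(** * Growth diagrams with two rows *)

(** (L1 i j, L2 i j) is a shape with two rows of length at most a, given for
    i <= j <= i + q.  It grows with j and shrinks with i by at most one box per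
    row; the ballot conditions say that a box of the second row arrives strictly
    after the box above it, and leaves strictly before.  In the square
    (i, j), (i, j + 1), (i + 1, j), (i + 1, j + 1) each row of the new intermediate
    shape is the mirror image of the old one between the two extreme lengths,
    except in the case where the box added in the second row is just below the
    one added in the first: then neither row can move. *)
Record two_row_growth (a q : nat) (L1 L2 : nat -> nat -> nat) : Prop := Growth {
  growth_diag : forall i, L1 i i = 0 /\ L2 i i = 0;
  growth_full : forall i, L1 i (i + q) = a /\ L2 i (i + q) = a;
  growth_le : forall i j, i <= j <= i + q -> L1 i j <= a /\ L2 i j <= a;
  growth_stepj : forall i j, i <= j < i + q ->
    [/\ L1 i j <= L1 i j.+1, L1 i j.+1 <= (L1 i j).+1,
        L2 i j <= L2 i j.+1 & L2 i j.+1 <= (L2 i j).+1];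
  growth_stepi : forall i j, i < j <= i + q ->
    [/\ L1 i.+1 j <= L1 i j, L1 i j <= (L1 i.+1 j).+1,
        L2 i.+1 j <= L2 i j & L2 i j <= (L2 i.+1 j).+1];
  growth_ballotj : forall i j, i <= j < i + q -> L2 i j.+1 <= L1 i j;
  growth_balloti : forall i j, i < j <= i + q -> L2 i j <= L1 i.+1 j;
  growth_toggle1 : forall i j, i < j < i + q ->
    L1 i.+1 j.+1 + L1 i j = L1 i j.+1 + L1 i.+1 j \/
    L1 i j.+1 + L1 i.+1 j < L1 i.+1 j.+1 + L1 i j /\ L2 i j.+1 = (L1 i.+1 j).+1;
  growth_toggle2 : forall i j, i < j < i + q ->
    L2 i.+1 j.+1 + L2 i j = L2 i j.+1 + L2 i.+1 j \/
    L2 i.+1 j.+1 + L2 i j < L2 i j.+1 + L2 i.+1 j /\ L2 i j.+1 = (L1 i.+1 j).+1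
}.

(** Complementing and rotating the shape at (j, i + q) in the 2 x a rectangle
    turns growth in one index into decrease in the other, and each axiom into
    another one or into itself. *)
Lemma growth_dual a q L1 L2 : two_row_growth a q L1 L2 ->
  two_row_growth a q (fun i j => a - L2 j (i + q)) (fun i j => a - L1 j (i + q)).
Proof.
move=> G; split.
- by move=> i; have [-> ->] := growth_full G i; rewrite subnn.
- by move=> i; have [-> ->] := growth_diag G (i + q); rewrite subn0.
- by move=> i j ij; rewrite !leq_subr.
- move=> i j ij.
  have [? ? ? ?] := growth_stepi G (i := j) (j := i + q) ltac:(lia).
  by split; lia.
- move=> i j ij; rewrite addSn.
  have [? ? ? ?] := growth_stepj G (i := j) (j := i + q) ltac:(lia).
  have [? ?] := growth_le G (i := j) (j := (i + q).+1) ltac:(lia).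
  by split; lia.
- move=> i j ij.
  by have := growth_balloti G (i := j) (j := i + q); lia.
- move=> i j ij; rewrite addSn.
  by have := growth_ballotj G (i := j) (j := i + q); lia.
- move=> i j ij; rewrite addSn.
  have [? ?] := growth_le G (i := j) (j := (i + q).+1) ltac:(lia).
  have [? ?] := growth_le G (i := j) (j := i + q) ltac:(lia).
  have [? ?] := growth_le G (i := j.+1) (j := (i + q).+1) ltac:(lia).
  have [? ?] := growth_le G (i := j.+1) (j := i + q) ltac:(lia).
  by have := growth_toggle2 G (i := j) (j := i + q); lia.
- move=> i j ij; rewrite addSn.
  have [? ?] := growth_le G (i := j) (j := (i + q).+1) ltac:(lia).
  have [? ?] := growth_le G (i := j) (j := i + q) ltac:(lia).
  have [? ?] := growth_le G (i := j.+1) (j := (i + q).+1) ltac:(lia).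
  have [? ?] := growth_le G (i := j.+1) (j := i + q) ltac:(lia).
  by have := growth_toggle1 G (i := j) (j := i + q); lia.
Qed.

Section GrowthIneq.
Variables (a q : nat) (L1 L2 : nat -> nat -> nat).
Hypothesis G : two_row_growth a q L1 L2.

(** The loss of the first row from i to i + 1 can only shrink as j grows, since
    an exceptional square only makes the first row at i + 1 longer. *)
Lemma growth_drop_antitone i k j : i < k -> k <= j <= i + q ->
  L1 i j + L1 i.+1 k <= L1 i k + L1 i.+1 j.
Proof.
move=> ik /andP[]; elim: j => [|j IHj]; first by lia.
rewrite leq_eqVlt => /predU1P[<- _|kj jq]; first by lia.
have := IHj ltac:(lia) ltac:(lia).
by have := growth_toggle1 G (i := i) (j := j) ltac:(lia); lia.
Qed.

(** The loss of the second row from i to i + 1 is 0 or 1 and nondecreasing in j.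
    It goes up only at an exceptional square, where the two rows are tied. *)
Lemma growth_jump i h k : i < h -> h <= k <= i + q ->
  L2 i k + L2 i.+1 h <= L2 i h + L2 i.+1 k \/
  exists2 m, h <= m < k & L2 i m = L2 i.+1 m /\ L2 i m.+1 = (L1 i.+1 m).+1.
Proof.
move=> ih /andP[]; elim: k => [|k IHk]; first by lia.
rewrite leq_eqVlt => /predU1P[<- _|hk kq]; first by left; lia.
have [|[m mk Em]] := IHk ltac:(lia) ltac:(lia); last first.
  by right; exists m => //; lia.
have [_ _ ? ?] := growth_stepi G (i := i) (j := k) ltac:(lia).
have [_ _ ? ?] := growth_stepi G (i := i) (j := k.+1) ltac:(lia).
have [|[? ?] ?] := growth_toggle2 G (i := i) (j := k) ltac:(lia); first by left; lia.
by right; exists k; lia.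
Qed.

(** Descending induction on i0, allowing k to vary.  If the second row loses
    nothing more between i and k when i0 becomes i0 + 1, the bound at k passes
    through.  Otherwise it starts losing at some m in between, where
    L1 i0 m = L2 i0 m + 1 and the first row also loses one box; the bound at m is
    then as good as the one at k, because the loss of the first row at j is at
    most the one at k, hence at most L1 i0 k - L2 i0 k. *)
Lemma growth_shift_ineq i0 i k j : i0 <= i <= k -> k <= j <= i0 + q ->
  L2 i0 k + L1 i0 j <= L1 i j + L2 i0 i + L1 i0 k.
Proof.
move=> /andP[]; move Dn : (i - i0) => n; elim: n => [|n IHn] in i0 Dn k *.
  move=> i0i ik kj; have Ei : i0 = i by lia.
  rewrite {}Ei in i0i Dn kj *; have := growth_diag G i.
  have : L2 i k <= L1 i k.
    case: (ltnP i k) => ?; last by have -> : k = i by [lia]; have := growth_diag G i; lia.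
    have := growth_balloti G (i := i) (j := k) ltac:(lia).
    by have [] := growth_stepi G (i := i) (j := k) ltac:(lia); lia.
  by lia.
move=> i0i ik kj.
have IH k' : i <= k' <= j ->
  L2 i0.+1 k' + L1 i0.+1 j <= L1 i j + L2 i0.+1 i + L1 i0.+1 k'.
  by move=> ?; apply: IHn; lia.
have drop_kj := growth_drop_antitone (i := i0) (k := k) (j := j) ltac:(lia) ltac:(lia).
have [nojump|[m mk [Em Em1]]] := growth_jump (i := i0) (h := i) (k := k) ltac:(lia) ltac:(lia).
  by have := IH k; lia.
have := IH m ltac:(lia).
have := growth_balloti G (i := i0) (j := k) ltac:(lia).
have [? ? ? ?] := growth_stepj G (i := i0) (j := m) ltac:(lia).
have [? ? ? ?] := growth_stepi G (i := i0) (j := m) ltac:(lia).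
have [? ? ? ?] := growth_stepi G (i := i0) (j := i) ltac:(lia).
have := growth_ballotj G (i := i0) (j := m) ltac:(lia).
by lia.
Qed.

Lemma growth_reciprocity_ge i j : i <= j <= i + q -> a <= L1 j (i + q) + L2 i j.
Proof.
move=> ij; have := growth_shift_ineq (i0 := i) (i := j) (k := i + q) (j := i + q).
by have := growth_full G i; lia.
Qed.

End GrowthIneq.

Lemma growth_reciprocity_le a q L1 L2 i j : two_row_growth a q L1 L2 ->
  i <= j <= i + q -> L2 (i + q) (j + q) + L1 j (i + q) <= a.
Proof.
move=> G ij; have /= := growth_reciprocity_ge (growth_dual G) ij.
have := growth_le G (i := i + q) (j := j + q) ltac:(lia).
have := growth_le G (i := j) (j := i + q) ltac:(lia).
by lia.
Qed.

(** Complementarity of the shapes at (i, j) and (j, i + q) forces period q in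
    both indices.  Having only inequalities, one gets a decreasing sequence
    L2 (i + l * q) (j + l * q), which is constant as soon as it is periodic. *)
Section Periodicity.
Variables (a q : nat) (L1 L2 : nat -> nat -> nat).
Hypothesis G : two_row_growth a q L1 L2.

Lemma growth_lower_decreasing l i j : i <= j <= i + q -> L2 (i + l * q) (j + l * q) <= L2 i j.
Proof.
move=> ij; elim: l => [|l IHl]; first by rewrite !addn0.
apply: leq_trans IHl; set i' := i + l * q; set j' := j + l * q.
have -> : i + l.+1 * q = i' + q by lia.
have -> : j + l.+1 * q = j' + q by lia.
have ij' : i' <= j' <= i' + q by lia.
have := growth_reciprocity_ge G ij'; have := growth_reciprocity_le G ij'.
lia.
Qed.

Variable p : nat.
Hypotheses (p_gt0 : 0 < p)
  (L2_periodic : forall i j, i <= j <= i + q -> L2 (i + q * p) (j + q * p) = L2 i j).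

Lemma growth_lower_periodic i j : i <= j <= i + q -> L2 (i + q) (j + q) = L2 i j.
Proof.
move=> ij; have shift k : k + q * p = k + q + p.-1 * q by case: p p_gt0 => //= n _; lia.
have := L2_periodic ij; rewrite !shift.
have := growth_lower_decreasing 1 ij; rewrite mul1n.
by have := @growth_lower_decreasing p.-1 (i + q) (j + q); lia.
Qed.

Lemma growth_upper_periodic i j : i <= j <= i + q -> q <= j -> L1 (i + q) (j + q) = L1 i j.
Proof.
move=> ij qj; have := growth_reciprocity_ge G (i := j - q) (j := i) ltac:(lia).
have := growth_reciprocity_le (i := j - q) (j := i) G ltac:(lia).
have := growth_reciprocity_ge G (i := j) (j := i + q) ltac:(lia).
have := growth_reciprocity_le (i := j) (j := i + q) G ltac:(lia).
have := @growth_lower_periodic (j - q) i ltac:(lia).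
have := @growth_lower_periodic j (i + q) ltac:(lia).
by rewrite subnK //; lia.
Qed.

End Periodicity.

(** * The field of an orbit and its diagonals *)

(** The orbit of a tableau with q = a + b + 1, in natural number coordinates;
    orbit_rule is the toggle rule. *)
Record tight_orbit (a b : nat) (t : nat -> nat -> nat -> nat) : Prop := TightOrbit {
  orbit_bound : forall n r c, r < a -> c < b -> r + c < t n r c <= r + c + 3;
  orbit_row : forall n r c, r < a -> c.+1 < b -> t n r c < t n r c.+1;
  orbit_col : forall n r c, r.+1 < a -> c < b -> t n r c < t n r.+1 c;
  orbit_rule : forall n r c j, r < a -> c < b -> 0 < j < a + b + 1 ->
    (t n.+1 r c <= j) =
    if t n r c <= j then
      [|| t n.+1 r c < j, (r.+1 < a) && (t n r.+1 c <= j.+1)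
        | (c.+1 < b) && (t n r c.+1 <= j.+1)]
    else [&& t n r c <= j.+1, (0 < r) ==> (t n.+1 r.-1 c < j)
           & (0 < c) ==> (t n.+1 r c.-1 < j)]
}.

Section Field.
Variables (a b : nat) (t : nat -> nat -> nat -> nat).
Hypothesis O : tight_orbit a b t.

(** The field, with k = 0, 1.  The column is an integer because diagonals leave
    the rectangle: beyond its left side everything is present, beyond its right
    side nothing is, as the toggle rule on the border requires. *)
Definition cell (n r : nat) (c : int) (k : nat) : bool :=
  match c with
  | Posz m => (m < b) && (t n r m <= r + m + k.+1)
  | Negz _ => true
  end.

Lemma cell_le n r c k k' : k <= k' -> cell n r c k -> cell n r c k'.
Proof. case: c => //= m kk' /andP[-> /=]; lia. Qed.

Lemma PoszS (m : nat) : (m%:Z + 1)%R = m.+1. Proof. lia. Qed.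

Lemma cell_right n r c k : r < a -> cell n r (c + 1)%R k -> cell n r c k.
Proof.
case: c => // m ra; rewrite PoszS /= => /andP[mb tm].
by have := orbit_row O n ra mb; lia.
Qed.

Lemma cell_down n r c k : r.+1 < a -> cell n r.+1 c k -> cell n r c k.
Proof.
case: c => //= m ra /andP[mb tm].
by have := orbit_col O n ra mb; lia.
Qed.

(** The toggle rule inside the field.  The level k is a third direction: the
    level below is always absent for k = 0 and the level above always present
    for k = 1, because of the tight bounds on the entries. *)
Lemma cellS n r (m : nat) k : r < a -> m < b -> k < 2 ->
  cell n.+1 r m k =
  if cell n r m k then
    [|| (0 < k) && cell n.+1 r m 0, (r.+1 < a) && cell n r.+1 m k
      | cell n r (m%:Z + 1)%R k]
  else [&& (k == 0) ==> cell n r m 1, (0 < r) ==> cell n.+1 r.-1 m k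
         & cell n.+1 r (m%:Z - 1)%R k].
Proof.
move=> ra mb k2; rewrite PoszS /= mb /=.
rewrite (orbit_rule O); [|by []..|lia].
have bnd := orbit_bound O n ra mb; have bnd' := orbit_bound O n.+1 ra mb.
case: ifP => [tm|/negbT]; last rewrite -ltnNge => tm.
  have -> : (r.+1 + m + k.+1) = (r + m + k.+1).+1 by lia.
  have -> : (r + m.+1 + k.+1) = (r + m + k.+1).+1 by lia.
  by congr orb; case: k k2 tm => [|[|]] //=; lia.
congr andb; first by lia.
congr andb; first by case: r {bnd bnd' tm} ra => //= r _; congr leq; lia.
case: m {bnd bnd' tm} mb => // m mb.
have -> : (Posz m.+1 - 1)%R = Posz m by lia.
by rewrite /=; lia.
Qed.

(** The next three facts are the order relations between neighbours one of
    which has already moved: a toggle never breaks the ideal. *)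
Lemma cell_next_down n r c k : r.+1 < a -> k < 2 -> cell n r.+1 c k -> cell n.+1 r c k.
Proof.
case: c => // m ra k2 down; have /andP[mb _] := down.
rewrite cellS //; last exact: ltnW.
by rewrite (cell_down ra down) ra down /= orbT.
Qed.

Lemma cell_next_right n r c k : r < a -> k < 2 -> cell n r (c + 1)%R k -> cell n.+1 r c k.
Proof.
case: c => // m ra k2 right; have := right; rewrite PoszS => /andP[/ltnW mb _].
rewrite cellS //.
by rewrite (cell_right ra right) right !orbT.
Qed.

Lemma cell_next_level n r c : r < a -> cell n.+1 r c 0 -> cell n r c 1.
Proof.
case: c => // m ra cur; have /andP[mb _] := cur.
move: cur; rewrite cellS //; case: ifP => [/cell_le -> //|_ /andP[]//].
Qed.

(** Box r of row k (counted from 0) of the shape at (i, j).  Moving along the row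
    follows a diagonal of the rectangle while time runs backwards; the first row
    reads the level 1 and the second row the level 0.  The shift of time by a
    keeps it nonnegative. *)
Definition shape_box k i j r : bool :=
  cell (a + j - r) r ((r + b + k + i)%:Z - j%:Z)%R (1 - k).

Lemma shape_boxE k i j r n c k' : n + r = a + j -> (c + j%:Z = r%:Z + b%:Z + k%:Z + i%:Z)%R ->
  k + k' = 1 -> shape_box k i j r = cell n r c k'.
Proof. by move=> *; rewrite /shape_box; congr cell; lia. Qed.

Definition shape_row k i j := count (shape_box k i j) (iota 0 a).

(** A decreasing predicate is determined by how often it holds; this makes
    shape_row a faithful encoding of the field. *)
Lemma count_initial (p : pred nat) n : (forall r, r.+1 < n -> p r.+1 -> p r) ->
  forall r, r < n -> p r = (r < count p (iota 0 n)).
Proof.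
elim: n => // n IHn down r; rewrite ltnS -[X in iota 0 X]addn1 iotaD count_cat /= addn0 add0n.
have le_cnt : count p (iota 0 n) <= n by rewrite -[leqRHS](size_iota 0) count_size.
have {}IHn := IHn (fun s sn => down s (leqW sn)).
case pn: (p n); rewrite leq_eqVlt => /predU1P[->|rn].
- rewrite pn addn1 ltnS; case: n {le_cnt} IHn down pn => // n IHn down pn.
  by rewrite -IHn // down.
- have pk k : k <= n -> p (n - k).
    elim: k => [|k IHk] kn; first by rewrite subn0.
    apply: down; first by lia.
    have -> : (n - k.+1).+1 = n - k by lia.
    by apply: IHk; lia.
  have pr : p r by rewrite -[r](subKn (ltnW rn)) pk // leq_subr.
  by rewrite pr addn1 ltnS leq_eqVlt -IHn // pr orbT.
- by rewrite pn addn0 ltnNge le_cnt.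
- by rewrite addn0 IHn.
Qed.

Lemma shape_row_le k i j : shape_row k i j <= a.
Proof. by rewrite -[leqRHS](size_iota 0) count_size. Qed.

Lemma shape_box_initial k i j r : k < 2 -> r < a -> shape_box k i j r = (r < shape_row k i j).
Proof.
move=> k2; apply: count_initial => {}r ra.
rewrite (shape_boxE (n := a + j - r.+1) (c := ((r + b + k + i)%:Z - j%:Z + 1)%R)
   (k' := 1 - k)); try lia.
rewrite (shape_boxE (n := (a + j - r.+1).+1) (c := ((r + b + k + i)%:Z - j%:Z)%R)
   (k' := 1 - k)); try lia.
move/(cell_right ra); apply: cell_next_down => //; lia.
Qed.

Lemma shape_row_mono k i j k' i' j' : k < 2 -> k' < 2 ->
  (forall r, r < a -> shape_box k i j r -> shape_box k' i' j' r) ->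
  shape_row k i j <= shape_row k' i' j'.
Proof.
move=> k2 k2' sub; rewrite leqNgt; apply/negP => lt; have ra : shape_row k' i' j' < a.
  exact: leq_trans lt (shape_row_le _ _ _).
by have := sub _ ra; rewrite !shape_box_initial // ltnn lt => /(_ isT).
Qed.

Lemma shape_row_monoS k i j k' i' j' : k < 2 -> k' < 2 ->
  (forall r, r.+1 < a -> shape_box k i j r.+1 -> shape_box k' i' j' r) ->
  shape_row k i j <= (shape_row k' i' j').+1.
Proof.
move=> k2 k2' sub; rewrite leqNgt; apply/negP => lt; have ra : (shape_row k' i' j').+1 < a.
  exact: leq_trans lt (shape_row_le _ _ _).
by have := sub _ ra; rewrite !shape_box_initial ?lt ?ltnn ?(ltnW ra) // => /(_ isT).
Qed.

Lemma shape_row_diag k i : k < 2 -> shape_row k i i = 0.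
Proof.
move=> k2; apply/eqP; rewrite -leqn0 leqNgt; apply/negP => pos.
have a0 := leq_trans pos (shape_row_le k i i).
have := shape_box_initial i i k2 a0; rewrite pos.
rewrite (shape_boxE (n := a + i) (c := (Posz (b + k))) (k' := 1 - k)) /=; lia.
Qed.

Lemma shape_row_full k i : k < 2 -> shape_row k i (i + (a + b + 1)) = a.
Proof.
move=> k2; apply/eqP; rewrite eqn_leq shape_row_le leqNgt; apply/negP => lt.
have := shape_box_initial i (i + (a + b + 1)) k2 lt; rewrite ltnn.
set r := shape_row _ _ _ in lt *.
rewrite (shape_boxE (n := a + (i + (a + b + 1)) - r) (c := Negz (a - k - r))
  (k' := 1 - k)) //=; lia.
Qed.

Lemma shape_row_stepj k i j : k < 2 ->
  shape_row k i j <= shape_row k i j.+1 /\ shape_row k i j.+1 <= (shape_row k i j).+1.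
Proof.
move=> k2; split.
  apply: shape_row_mono => // r ra; pose c := (Posz (r + b + k + i) - Posz j.+1)%R.
  rewrite (shape_boxE (n := a + j - r) (c := (c + 1)%R) (k' := 1 - k)) /c; try lia.
  rewrite (shape_boxE (n := (a + j - r).+1) (c := c) (k' := 1 - k)) /c; try lia.
  by apply: cell_next_right => //; lia.
apply: shape_row_monoS => // r ra; pose c := (Posz (r + b + k + i) - Posz j)%R.
rewrite (shape_boxE (n := a + j - r) (c := c) (k' := 1 - k)) /c; try lia.
rewrite (shape_boxE (n := a + j - r) (c := c) (k' := 1 - k)) /c; try lia.
exact: cell_down.
Qed.

Lemma shape_row_stepi k i j : k < 2 ->
  shape_row k i.+1 j <= shape_row k i j /\ shape_row k i j <= (shape_row k i.+1 j).+1.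
Proof.
move=> k2; split.
  apply: shape_row_mono => // r ra; pose c := (Posz (r + b + k + i) - Posz j)%R.
  rewrite (shape_boxE (n := a + j - r) (c := (c + 1)%R) (k' := 1 - k)) /c; try lia.
  rewrite (shape_boxE (n := a + j - r) (c := c) (k' := 1 - k)) /c; try lia.
  exact: cell_right.
apply: shape_row_monoS => // r ra; pose c := (Posz (r + b + k + i.+1) - Posz j)%R.
rewrite (shape_boxE (n := a + j - r.+1) (c := c) (k' := 1 - k)) /c; try lia.
rewrite (shape_boxE (n := (a + j - r.+1).+1) (c := c) (k' := 1 - k)) /c; try lia.
by apply: cell_next_down => //; lia.
Qed.

Lemma shape_row_ballotj i j : shape_row 1 i j.+1 <= shape_row 0 i j.
Proof.
apply: shape_row_mono => // r ra; pose c := (Posz (r + b + i) - Posz j)%R.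
rewrite (shape_boxE (n := (a + j - r).+1) (c := c) (k' := 0)) /c; try lia.
rewrite (shape_boxE (n := a + j - r) (c := c) (k' := 1)) /c; try lia.
exact: cell_next_level.
Qed.

Lemma shape_row_balloti i j : shape_row 1 i j <= shape_row 0 i.+1 j.
Proof.
apply: shape_row_mono => // r ra; pose c := (Posz (r + b + i.+1) - Posz j)%R.
rewrite (shape_boxE (n := a + j - r) (c := c) (k' := 0)) /c; try lia.
rewrite (shape_boxE (n := a + j - r) (c := c) (k' := 1)) /c; try lia.
exact: cell_le.
Qed.

(** The only box that can tell the four corners of a square apart lies inside
    the a x b rectangle, except at the two ends of a growth diagram: at j = i + 1
    the second row is bounded by an empty first row, and at j = i + q - 1 the
    first row is held by a full second one. *)
Lemma shape_row_square k i j (r := shape_row k i.+1 j) (c := (Posz (r + b + k + i) - Posz j)%R) :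
  k < 2 -> i < j < i + (a + b + 1) -> shape_row k i j.+1 = r.+1 ->
  [\/ exists2 m, c = Posz m & m < b,
      [/\ k = 1, j = i.+1 & r = 0] |
      [/\ k = 0, j = i + (a + b), r.+1 = a & c = Negz 0] ].
Proof.
move=> k2 ij Enu; have ra : r < a by rewrite /r -Enu shape_row_le.
case Ec : c => [m|m].
  have [mb|bm] := ltnP m b; first by constructor 1; exists m.
  constructor 2; case: (posnP r) => [r0|r0]; first by split=> //; lia.
  have := shape_box_initial i.+1 j k2 (leq_ltn_trans (leq_pred r) ra).
  rewrite -/r (_ : r.-1 < r) ?prednK //.
  rewrite (shape_boxE (n := (a + j - r).+1) (c := m) (k' := 1 - k)) /=; lia.
constructor 3; have [r1a|ar1] := ltnP r.+1 a; last by split=> //; lia.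
have := shape_box_initial i j.+1 k2 r1a.
rewrite Enu ltnn.
by rewrite (shape_boxE (n := a + j - r) (c := (Negz m)) (k' := 1 - k)) //=; lia.
Qed.

(** The vertical neighbours of a box in the rectangle are its horizontal
    neighbours in the two-row shape; beyond the last box added nothing is there
    yet, and before it everything is. *)
Lemma shape_box_below k i j r m : k < 2 -> shape_row k i j.+1 = r.+1 -> r < a ->
  Posz m = (Posz (r + b + k + i) - Posz j)%R ->
  (r.+1 < a) && cell (a + j - r) r.+1 m (1 - k) = false.
Proof.
move=> k2 Enu ra Em; case: ltnP => //= r1a; have := shape_box_initial i j.+1 k2 r1a.
by rewrite Enu ltnn (shape_boxE (n := a + j - r) (c := m) (k' := 1 - k)) //; lia.
Qed.

Lemma shape_box_above k i j r m : k < 2 -> shape_row k i.+1 j = r -> r < a ->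
  Posz m = (Posz (r + b + k + i) - Posz j)%R ->
  (0 < r) ==> cell (a + j - r).+1 r.-1 m (1 - k).
Proof.
move=> k2 Ela ra Em; apply/implyP => r0.
have := shape_box_initial i.+1 j k2 (leq_ltn_trans (leq_pred r) ra).
by rewrite Ela prednK // leqnn (shape_boxE (n := (a + j - r).+1) (c := m) (k' := 1 - k)) //; lia.
Qed.

Lemma shape_row_toggle1 i j : i < j < i + (a + b + 1) ->
  shape_row 0 i.+1 j.+1 + shape_row 0 i j = shape_row 0 i j.+1 + shape_row 0 i.+1 j \/
  shape_row 0 i j.+1 + shape_row 0 i.+1 j < shape_row 0 i.+1 j.+1 + shape_row 0 i j /\
  shape_row 1 i j.+1 = (shape_row 0 i.+1 j).+1.
Proof.
move=> ij; have [? ?] := @shape_row_stepj 0 i j isT; have [? ?] := @shape_row_stepj 0 i.+1 j isT.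
have [? ?] := @shape_row_stepi 0 i j isT; have [? ?] := @shape_row_stepi 0 i j.+1 isT.
have [Enu|?] := eqVneq (shape_row 0 i j.+1) (shape_row 0 i.+1 j).+1; last by left; lia.
have ra : shape_row 0 i.+1 j < a by rewrite -Enu shape_row_le.
have mu := shape_box_initial i j (isT : 0 < 2) ra.
have mu' := shape_box_initial i.+1 j.+1 (isT : 0 < 2) ra.
have nu := shape_box_initial i j.+1 (isT : 0 < 2) ra.
have nu2 := shape_box_initial i j.+1 (isT : 1 < 2) ra.
have la := shape_box_initial i.+1 j (isT : 0 < 2) ra.
have up := @shape_box_above 0 i j _ _ isT erefl ra.
have down := @shape_box_below 0 i j _ _ isT Enu ra.
have := shape_row_square (isT : 0 < 2) ij Enu.
(* mu, mu' are the old and new values at the toggled point of the field, whose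
   neighbours are nu on the left, la on the right and nu2 on the level below *)
set r := shape_row 0 i.+1 j in ra Enu mu mu' nu nu2 la up down *.
pose c := (Posz (r + b + i) - Posz j)%R.
rewrite (shape_boxE (n := a + j - r) (c := c) (k' := 1)) /c in mu; try lia.
rewrite (shape_boxE (n := (a + j - r).+1) (c := c) (k' := 1)) /c in mu'; try lia.
rewrite (shape_boxE (n := (a + j - r).+1) (c := (c - 1)%R) (k' := 1)) /c in nu; try lia.
rewrite (shape_boxE (n := (a + j - r).+1) (c := c) (k' := 0)) /c in nu2; try lia.
rewrite (shape_boxE (n := a + j - r) (c := (c + 1)%R) (k' := 1)) /c in la; try lia.
rewrite addn0 -/c; case=> [[m Em mb]|[]//|[_ Ej Er Ec]]; last first.
  right; have := @shape_row_full 1 i isT; rewrite (_ : i + (a + b + 1) = j.+1); last by lia.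
  by move: mu mu'; rewrite -/c Ec /=; lia.
have le2 := shape_row_ballotj i j.
have {}up := up m ltac:(lia); have {}down := down m ltac:(lia).
rewrite -/c Em in mu mu' nu nu2 la.
move: mu'; rewrite cellS // mu nu nu2 la up down Enu.
by case: ifP; lia.
Qed.

Lemma shape_row_toggle2 i j : i < j < i + (a + b + 1) ->
  shape_row 1 i.+1 j.+1 + shape_row 1 i j = shape_row 1 i j.+1 + shape_row 1 i.+1 j \/
  shape_row 1 i.+1 j.+1 + shape_row 1 i j < shape_row 1 i j.+1 + shape_row 1 i.+1 j /\
  shape_row 1 i j.+1 = (shape_row 0 i.+1 j).+1.
Proof.
move=> ij; have [? ?] := @shape_row_stepj 1 i j isT; have [? ?] := @shape_row_stepj 1 i.+1 j isT.
have [? ?] := @shape_row_stepi 1 i j isT; have [? ?] := @shape_row_stepi 1 i j.+1 isT.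
have [Enu|?] := eqVneq (shape_row 1 i j.+1) (shape_row 1 i.+1 j).+1; last by left; lia.
have ra : shape_row 1 i.+1 j < a by rewrite -Enu shape_row_le.
have mu := shape_box_initial i j (isT : 1 < 2) ra.
have mu' := shape_box_initial i.+1 j.+1 (isT : 1 < 2) ra.
have nu := shape_box_initial i j.+1 (isT : 1 < 2) ra.
have la1 := shape_box_initial i.+1 j (isT : 0 < 2) ra.
have la := shape_box_initial i.+1 j (isT : 1 < 2) ra.
have up := @shape_box_above 1 i j _ _ isT erefl ra.
have down := @shape_box_below 1 i j _ _ isT Enu ra.
have := shape_row_square (isT : 1 < 2) ij Enu.
(* as for the first row, with la1 on the level above the toggled point *)
set r := shape_row 1 i.+1 j in ra Enu mu mu' nu la1 la up down *.
pose c := (Posz (r + b + 1 + i) - Posz j)%R.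
rewrite (shape_boxE (n := a + j - r) (c := c) (k' := 0)) /c in mu; try lia.
rewrite (shape_boxE (n := (a + j - r).+1) (c := c) (k' := 0)) /c in mu'; try lia.
rewrite (shape_boxE (n := (a + j - r).+1) (c := (c - 1)%R) (k' := 0)) /c in nu; try lia.
rewrite (shape_boxE (n := a + j - r) (c := c) (k' := 1)) /c in la1; try lia.
rewrite (shape_boxE (n := a + j - r) (c := (c + 1)%R) (k' := 0)) /c in la; try lia.
rewrite -/c; case=> [[m Em mb]|[_ Ej Er]|[]//]; last first.
  right; have := @shape_row_diag 0 i.+1 isT; rewrite -{2}Ej.
  by move: mu mu'; rewrite (_ : (_ - _)%R = Posz b) /=; lia.
have le2 := shape_row_balloti i j.
have {}up := up m ltac:(lia); have {}down := down m ltac:(lia).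
rewrite -/c Em in mu mu' nu la1 la.
move: mu'; rewrite cellS // mu nu la1 la up down Enu.
by case: ifP; lia.
Qed.

Lemma tight_orbit_growth : two_row_growth a (a + b + 1) (shape_row 0) (shape_row 1).
Proof.
split.
- by move=> i; rewrite !shape_row_diag.
- by move=> i; rewrite !shape_row_full.
- by move=> i j _; rewrite !shape_row_le.
- move=> i j _; have [? ?] := @shape_row_stepj 0 i j isT; have [? ?] := @shape_row_stepj 1 i j isT.
  by split.
- move=> i j _; have [? ?] := @shape_row_stepi 0 i j isT; have [? ?] := @shape_row_stepi 1 i j isT.
  by split.
- by move=> i j _; apply: shape_row_ballotj.
- by move=> i j _; apply: shape_row_balloti.
- exact: shape_row_toggle1.
- exact: shape_row_toggle2.
Qed.

End Field.

(** * The order of K-promotion *)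

Section Order.
Variables a b : nat.
Notation q := (a + b + 1).
Implicit Types T : 'M[nat]_(a, b).

(** Total in both coordinates, so that neighbours need no proof of membership. *)
Definition entry (T : 'M[nat]_(a, b)) (r c : nat) : nat :=
  if (insub r, insub c) is (Some i, Some j) then T i j else 0.

Lemma entryE T (x : box a b) : entry T x.1 x.2 = label T x.
Proof. by rewrite /entry !valK. Qed.

Lemma incr_iter T n : incr q T -> incr q (iter n (KPro q) T).
Proof. by move=> incT; elim: n => //= n; apply: incr_KPro. Qed.

Lemma iter_KPro_inj m T1 T2 : incr q T1 -> incr q T2 ->
  iter m (KPro q) T1 = iter m (KPro q) T2 -> T1 = T2.
Proof.
move=> i1 i2; elim: m => //= m IHm Em; apply: IHm.
exact: KPro_inj (incr_iter m i1) (incr_iter m i2) Em.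
Qed.

Lemma incr_lower T (x : box a b) : incr q T -> x.1 + x.2 < label T x.
Proof.
move=> [bnd cov]; case: x => -[r ra] [c cb] /=.
elim: r ra => [|r IHr] ra.
  elim: c cb => [|c IHc] cb; first by have := bnd (Ordinal ra, Ordinal cb); lia.
  apply: leq_ltn_trans (IHc (ltnW cb)) _; apply: cov.
  by rewrite /covers /= !eqxx.
apply: leq_ltn_trans (IHr (ltnW ra)) _; apply: cov.
by rewrite /covers /= !eqxx orbT.
Qed.

Lemma incr_upper T (x : box a b) : incr q T -> label T x <= x.1 + x.2 + 3.
Proof.
move=> [bnd cov]; case: x => -[r ra] [c cb] /=.
move Ek : (a - r.+1) => k; elim: k r ra Ek => [|k IHk] r ra Ek; last first.
  have ra1 : r.+1 < a by lia.
  have := cov (Ordinal ra, Ordinal cb) (Ordinal ra1, Ordinal cb).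
  rewrite /covers /= !eqxx orbT => /(_ isT).
  have := IHk r.+1 ra1; lia.
move El : (b - c.+1) => l; elim: l c cb El => [|l IHl] c cb El.
  by have := bnd (Ordinal ra, Ordinal cb); lia.
have cb1 : c.+1 < b by lia.
have := cov (Ordinal ra, Ordinal cb) (Ordinal ra, Ordinal cb1).
rewrite /covers /= !eqxx => /(_ isT).
have := IHl c.+1 cb1; lia.
Qed.

Lemma exists_covers (p : nat -> nat -> bool) (x : box a b) :
  [exists y : box a b, covers x y && p y.1 y.2] =
  (x.1.+1 < a) && p x.1.+1 x.2 || (x.2.+1 < b) && p x.1 x.2.+1.
Proof.
case: x => r c /=; apply/existsP/orP => [[[r' c'] /= /andP[]]|[] /andP[lt pn]].
- by case/orP=> /= /andP[/eqP <- /eqP E]; [right | left]; rewrite E ltn_ord.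
- by exists (Ordinal lt, c); rewrite /covers /= !eqxx orbT.
- by exists (r, Ordinal lt); rewrite /covers /= !eqxx.
Qed.

Lemma forall_covers (p : nat -> nat -> bool) (x : box a b) :
  [forall y : box a b, covers y x ==> p y.1 y.2] =
  ((0 < x.1) ==> p x.1.-1 x.2) && ((0 < x.2) ==> p x.1 x.2.-1).
Proof.
case: x => r c /=; apply/forallP/andP => [all|[rows cols] [r' c']]; last first.
  apply/implyP=> /orP[] /= /andP[/eqP -> /eqP E].
    by move: cols; rewrite -E.
  by move: rows; rewrite -E.
split; apply/implyP => pos.
  have lt : r.-1 < a by apply: leq_ltn_trans (leq_pred _) (ltn_ord r).
  have /implyP := all (Ordinal lt, c); apply.
  by rewrite /covers /= prednK // !eqxx orbT.
have lt : c.-1 < b by apply: leq_ltn_trans (leq_pred _) (ltn_ord c).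
have /implyP := all (r, Ordinal lt); apply.
by rewrite /covers /= prednK // !eqxx.
Qed.

Lemma entry_rule T r c j : incr q T -> r < a -> c < b -> 0 < j < q ->
  (entry (KPro q T) r c <= j) =
    if entry T r c <= j then
      [|| entry (KPro q T) r c < j, (r.+1 < a) && (entry T r.+1 c <= j.+1)
        | (c.+1 < b) && (entry T r c.+1 <= j.+1)]
    else [&& entry T r c <= j.+1, (0 < r) ==> (entry (KPro q T) r.-1 c < j)
           & (0 < c) ==> (entry (KPro q T) r c.-1 < j)].
Proof.
move=> incT ra cb jq; pose x : box a b := (Ordinal ra, Ordinal cb).
have := KPro_le x incT jq; rewrite -!entryE /= => ->.
under eq_existsb => y do rewrite -entryE.
under eq_forallb => y do rewrite -entryE.
by rewrite (exists_covers (fun r c => entry T r c <= j.+1))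
  (forall_covers (fun r c => entry (KPro q T) r c < j)).
Qed.

Lemma tight_orbit_KPro T : incr q T ->
  tight_orbit a b (fun n => entry (iter n (KPro q) T)).
Proof.
move=> incT; split=> [n r c ra cb|n r c ra cb|n r c ra cb|n r c j ra cb jq].
- have incTn := incr_iter n incT; pose x : box a b := (Ordinal ra, Ordinal cb).
  by have := incr_lower x incTn; have := incr_upper x incTn; rewrite -entryE /=; lia.
- have [_ cov] := incr_iter n incT.
  have := cov (Ordinal ra, Ordinal (ltnW cb)) (Ordinal ra, Ordinal cb).
  by rewrite -!entryE /= /covers /= !eqxx; apply.
- have [_ cov] := incr_iter n incT.
  have := cov (Ordinal (ltnW ra), Ordinal cb) (Ordinal ra, Ordinal cb).
  by rewrite -!entryE /= /covers /= !eqxx orbT; apply.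
- exact: entry_rule (incr_iter n incT) _ _ _.
Qed.

(** Pigeonhole gives two equal iterates, and injectivity brings the coincidence
    back to the start. *)
Lemma iter_periodic T : incr q T -> exists2 p, 0 < p & iter p (KPro q) T = T.
Proof.
move=> incT; pose code n : {ffun box a b -> 'I_q.+1} :=
  [ffun x => inord (label (iter n (KPro q) T) x)].
have codeP m n : code m = code n -> iter m (KPro q) T = iter n (KPro q) T.
  move=> E; apply/matrixP => r c; have /ffunP/(_ (r, c)) := E.
  rewrite !ffunE => /(congr1 val) /=.
  have [/(_ (r, c)) bm _] := incr_iter m incT.
  have [/(_ (r, c)) bn _] := incr_iter n incT.
  by rewrite !inordK //; lia.
pose N := #|{: {ffun box a b -> 'I_q.+1}}|.
have : ~~ injectiveb (fun i : 'I_N.+1 => code i).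
  by apply/injectiveP => /leq_card; rewrite card_ord ltnn.
case/injectivePn => i [j ij /codeP Eij].
wlog lt_ij : i j ij Eij / i < j.
  move=> W; case: (ltngtP i j) => [lt|lt|/val_inj E]; last by rewrite E eqxx in ij.
    exact: W Eij lt.
  by apply: (W j i) => //; rewrite eq_sym.
exists (j - i); first by rewrite subn_gt0.
have : iter i (KPro q) (iter (j - i) (KPro q) T) = iter i (KPro q) T.
  by rewrite -iterD subnKC // ltnW.
exact: iter_KPro_inj (incr_iter _ incT) incT.
Qed.

Lemma iter_periods T p n : iter p (KPro q) T = T -> iter (n * p) (KPro q) T = T.
Proof. by move=> pT; elim: n => //= n IHn; rewrite mulSn iterD IHn. Qed.

(** Only the field at late times is covered by the growth diagram, so the period
    q is proved around a large multiple n of a period p and then carried back to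
    time 0. *)
Lemma KPro_order T : incr q T -> iter q (KPro q) T = T.
Proof.
move=> incT; have [p p0 pT] := iter_periodic incT.
have O := tight_orbit_KPro incT; set t := fun n => _ in O.
have G := tight_orbit_growth O.
have t_p n l r c : t (n + l * p) r c = t n r c by rewrite /t iterD iter_periods.
have L_p k i j : shape_row a b t k (i + q * p) (j + q * p) = shape_row a b t k i j.
  apply: eq_in_count => r; rewrite mem_iota add0n => /andP[_ ra].
  rewrite /shape_box (_ : a + (j + q * p) - r = a + j - r + q * p); last by lia.
  rewrite (_ : (Posz _ - Posz (j + _))%R = (Posz (r + b + k + i) - Posz j)%R); last by lia.
  by rewrite /cell; case: (_ - _)%R => // m; rewrite t_p.
have L_q k i j : k < 2 -> i <= j <= i + q -> q <= j ->
    shape_row a b t k (i + q) (j + q) = shape_row a b t k i j.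
  case: k => [|[|//]] _ ij qj.
    exact: (growth_upper_periodic G p0 (fun i j _ => L_p 1 i j)).
  exact: (growth_lower_periodic G p0 (fun i j _ => L_p 1 i j)).
pose n := 2 * q * p; have n_large : 2 * q <= n by rewrite leq_pmulr.
have cell_q r m k : r < a -> m < b -> k < 2 ->
    cell b t (n + q) r m (1 - k) = cell b t n r m (1 - k).
  move=> ra mb k2; pose j := n + r - a; pose i := m + j - (r + b + k).
  rewrite -(@shape_boxE a b t k i j r n m) /i /j; try lia.
  rewrite -(@shape_boxE a b t k (i + q) (j + q) r (n + q) m) /i /j; try lia.
  by rewrite !(shape_box_initial O) // L_q //; lia.
have t_q r m : r < a -> m < b -> t q r m = t 0 r m.
  move=> ra mb; rewrite -(t_p q (2 * q)) -(t_p 0 (2 * q)) add0n addnC -/n.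
  (* the two levels determine which of three consecutive values an entry has *)
  have := cell_q r m 0 ra mb isT; have := cell_q r m 1 ra mb isT; rewrite /cell mb /=.
  by have := orbit_bound O (n + q) ra mb; have := orbit_bound O n ra mb; lia.
apply/matrixP => r c; have := t_q r c (ltn_ord r) (ltn_ord c).
rewrite /t /=; have := entryE (iter q (KPro q) T) (r, c); rewrite /= => ->.
by have := entryE T (r, c); rewrite /= => ->.
Qed.

Lemma has_label_iter T m k : incr q T -> 1 <= k <= q ->
  has_label (iter m (KPro q) T) k = has_label T ((k.-1 + m) %% q).+1.
Proof.
move=> incT; elim: m k => [|m IHm] k kq.
  by rewrite addn0 modn_small ?prednK //; lia.
rewrite iterS has_label_KPro //; last exact: incr_iter.
case: ifP => [/eqP ->|kNq]; rewrite IHm; try lia.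
  by have -> : q.-1 + m.+1 = m + q by [lia]; rewrite modnDr.
by have -> : k.-1 + m.+1 = k + m by lia.
Qed.

Definition minimal_tableau : 'M[nat]_(a, b) := (\matrix_(r, c) (r + c).+1)%R.

Lemma label_minimal x : label minimal_tableau x = (x.1 + x.2).+1.
Proof. by rewrite /label mxE. Qed.

Lemma incr_minimal : incr q minimal_tableau.
Proof.
split=> [x|x y]; rewrite !label_minimal; first by have := ltn_ord x.1; have := ltn_ord x.2; lia.
by rewrite /covers; case/orP=> /andP[/eqP -> /eqP <-]; lia.
Qed.

Lemma has_label_minimal l : 0 < a -> 0 < b -> has_label minimal_tableau l = (0 < l < a + b).
Proof.
move=> a0 b0; apply/existsP/idP => [[x /eqP <-]|l_ab].
  by rewrite label_minimal; have := ltn_ord x.1; have := ltn_ord x.2; lia.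
have ra : minn l.-1 a.-1 < a by lia.
have cb : l.-1 - minn l.-1 a.-1 < b by lia.
by exists (Ordinal ra, Ordinal cb); rewrite label_minimal /=; lia.
Qed.

Lemma KPro_order_ge m : 0 < a -> 0 < b -> 0 < m ->
  iter m (KPro q) minimal_tableau = minimal_tableau -> q <= m.
Proof.
move=> a0 b0 m0 fixT; rewrite leqNgt; apply/negP => mq.
have rot k : 1 <= k <= q -> (0 < k < a + b) = (0 < ((k.-1 + m) %% q).+1 < a + b).
  by move=> kq; rewrite -!has_label_minimal // -{1}fixT has_label_iter //; exact: incr_minimal.
(* absence of the label q forces m = q - 1, and then absence of q - 1 fails *)
have := rot q ltac:(lia); have -> : q.-1 + m = m.-1 + q by lia.
rewrite modnDr modn_small; last by lia.
move=> rot_q; have := rot q.-1 ltac:(lia); have -> : q.-1.-1 + m = m - 2 + q by lia.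
by rewrite modnDr modn_small; lia.
Qed.

End Order.

Theorem corollary4p10 (a b : nat) (ha : 1 <= a) (hb : 1 <= b) :
  is_order_on (@Inc a b (a + b + 1)) (@KPro a b (a + b + 1)) (a + b + 1).
Proof.
split=> [|T /IncP|m m0 fix_m]; [by rewrite addn1 | exact: KPro_order|].
apply: (KPro_order_ge (a := a) (b := b)) => //.
by apply: fix_m; apply/IncP; exact: incr_minimal.
Qed.
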